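(* Let $r$ be a positive integer, $a>0$, and $\mathbf{w}=(w_1,\ldots,w_r)$ with $w_1,\ldots,w_r>0$ real, and let $d=\dim_{\mathbb{Q}}\langle w_1,\ldots,w_r\rangle$ (so $1\le d\le r$). Assume that the derivative $\zeta_r'(s,a,\mathbf{w})$ with respect to $s$ has polynomial growth in the vertical strip $r-\frac d2\le\sigma\le r$, that is, there exists a constant $B>0$ such that $\zeta_r'(\sigma+it,a,\mathbf{w})=O(t^{B})$ for $t\ge 2$, uniformly for $r-\frac d2\le\sigma\le r$. Then the following two assertions are equivalent. (i) For every $\varepsilon>0$ and every real $\sigma$ with $r-\frac d2\le\sigma\le r$, $$\zeta_r(\sigma+it,a,\mathbf{w})=O(t^{\varepsilon})\qquad (t\to\infty).$$ (ii) For every positive integer $k$, every $\varepsilon>0$ and every real $\sigma$ with $r-\frac d2\le\sigma\le r$, $$\int_2^T\left|\zeta_r(\sigma+it,a,\mathbf{w})\right|^{2k}\,dt=O(T^{1+\varepsilon})\qquad (T\to\infty).$$ Here the implied constants in (i) and (ii) may depend on $\varepsilon$, $k$, $\sigma$, $a$ and $\mathbf{w}$.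
   Context: For a positive integer $r$, a real number $a>0$, and $\mathbf{w}=(w_1,\ldots,w_r)$ with all $w_j>0$ real, the Barnes multiple zeta function is $$\zeta_r(s,a,\mathbf{w})=\sum_{m_1=0}^\infty\cdots\sum_{m_r=0}^\infty\frac{1}{(a+m_1w_1+\cdots+m_rw_r)^s},$$ where $s=\sigma+it$ is a complex variable with $\sigma,t$ real. The series converges absolutely for $\mathrm{Re}(s)>r$, and $\zeta_r(s,a,\mathbf{w})$ denotes also its meromorphic continuation to the whole complex $s$-plane, whose only possible poles are simple poles at $s=1,\ldots,r$. The symbol $\zeta_r'(s,a,\mathbf{w})$ denotes $\frac{\partial}{\partial s}\zeta_r(s,a,\mathbf{w})$. The notation $\langle w_1,\ldots,w_r\rangle$ means the $\mathbb{Q}$-linear subspace of $\mathbb{R}$ spanned by $w_1,\ldots,w_r$. *)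

(* Defs.v *)
From Stdlib Require Import QArith_base Qreals Reals List.
From Coquelicot Require Import Coquelicot.
Import ListNotations.
Open Scope R_scope.

Definition Qcomb (c : list Q) (v : list R) : R :=
  fold_right Rplus 0 (map (fun p => Q2R (fst p) * snd p) (combine c v)).

Definition in_Qspan (v : list R) (x : R) : Prop :=
  exists c : list Q, length c = length v /\ x = Qcomb c v.

Definition Qindependent (v : list R) : Prop :=
  forall c : list Q, length c = length v -> Qcomb c v = 0 ->
    List.Forall (fun q => Qeq q 0) c.

(** [d] is the dimension of the [Q]-linear span of [w] in [R]. *)
Definition Qspan_dim (w : list R) (d : nat) : Prop :=
  exists b : list R,
    length b = d /\ Qindependent b /\
    (forall x : R, in_Qspan b x <-> in_Qspan w x).

(** [x ^ s = exp (s ln x)] for real [x > 0] and complex [s]. *)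
Definition RCpower (x : R) (s : C) : C :=
  (Rpower x (Re s) * cos (Im s * ln x), Rpower x (Re s) * sin (Im s * ln x)).

(** The iterated series
    [sum_(m1 >= 0) ... sum_(mr >= 0) 1 / (a + m1 w1 + ... + mr wr) ^ s]
    converges to [l]; the terms [mj wj] are absorbed into [a] one by one. *)
Fixpoint is_barnes_series (w : list R) (a : R) (s l : C) : Prop :=
  match w with
  | [] => l = (/ RCpower a s)%C
  | w1 :: w' =>
      exists u : nat -> C,
        (forall m : nat, is_barnes_series w' (a + INR m * w1) s (u m)) /\
        @is_series C_AbsRing C_NormedModule u l
  end.

Definition holomorphic_at (f : C -> C) (s : C) : Prop :=
  locally s (fun z => @ex_derive C_AbsRing C_NormedModule f z).

(** The value of [f] at the pole itself is irrelevant. *)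
Definition simple_pole_at (f : C -> C) (s : C) : Prop :=
  locally' s (fun z => @ex_derive C_AbsRing C_NormedModule f z) /\
  exists rho : C, rho <> RtoC 0 /\
    filterlim (fun z => ((z - s) * f z)%C) (locally' s) (locally rho).

(** [zeta] is the meromorphic function [s |-> zeta_r(s, a, w)] on [C], where
    [r = length w].  By the identity theorem this determines [zeta] away from
    its poles. *)
Definition is_barnes_zeta (a : R) (w : list R) (zeta : C -> C) : Prop :=
  (forall s : C, INR (length w) < Re s -> is_barnes_series w a s (zeta s)) /\
  (forall s : C,
     holomorphic_at zeta s \/
     (simple_pole_at zeta s /\
      exists j : nat, (1 <= j <= length w)%nat /\ s = RtoC (INR j))).

(** [f t = O (g t)] as [t] tends to [+oo]. *)
Definition bigO_infty (f g : R -> R) : Prop :=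
  exists K : R, Rbar_locally p_infty (fun t => Rabs (f t) <= K * Rabs (g t)).

(** [f (sigma + i t) = O (t ^ B)] for [t >= 2], for some [B > 0], uniformly for
    [sigma1 <= sigma <= sigma2]. *)
Definition polynomial_growth (f : C -> C) (sigma1 sigma2 : R) : Prop :=
  exists B : R, 0 < B /\ exists K : R,
    forall sigma t : R, sigma1 <= sigma <= sigma2 -> 2 <= t ->
      Cmod (f (sigma, t)) <= K * Rpower t B.

(* Main.v *)
(** Writing [f t = zeta (sigma + i t)], (i) implies (ii) by integrating the
    pointwise bound.  Conversely, polynomial growth [f' t = O (t ^ B)] makes [f]
    vary by [O (1)] on the interval [[t, t + t ^ - B]], so either [f t] is
    bounded or [|f| >= |f t| / 2] on that whole interval.  In the second case the
    [2k]-th moment gives [|f t| ^ (2k) t ^ - B = O (t ^ 2)], and letting [k] grow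
    makes the exponent [(B + 2) / (2k)] of [t] arbitrarily small. *)
Require Import Defs.
From Stdlib Require Import Reals List Lra Lia.
From Coquelicot Require Import Coquelicot.
Open Scope R_scope.

Lemma Rpower_ge_1 (x y : R) : 1 <= x -> 0 <= y -> 1 <= Rpower x y.
Proof.
intros hx hy; rewrite <- (Rpower_O x) by lra.
now apply Rle_Rpower.
Qed.

Lemma Rpower_pow_mult (x y : R) (n : nat) :
  Rpower x y ^ n = Rpower x (INR n * y).
Proof.
rewrite <- Rpower_pow by apply exp_pos.
now rewrite Rpower_mult, Rmult_comm.
Qed.

(** * Calculus along a vertical line *)

(** By the chain rule [u |-> f (sigma + i u)] has derivative [i l], whose components are [- Im l]
    and [Re l]. *)
Lemma is_derive_vertical (f : C -> C) (sigma t : R) (l : C) :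
  @is_derive C_AbsRing C_NormedModule f (sigma, t) l ->
  is_derive (fun u => Re (f (sigma, u))) t (- Im l) /\
  is_derive (fun u => Im (f (sigma, u))) t (Re l).
Proof.
intros [_ hd].
assert (hd' : forall eps : posreal, locally t (fun u =>
  Cmod (f (sigma, u) - f (sigma, t) - (0, u - t)%R * l)%C <= eps * Rabs (u - t))).
{ intros eps.
  destruct (hd (sigma, t) (fun P H => H) eps) as [delta hdelta].
  exists delta; intros u hu.
  assert (hdist : Cmod ((sigma, u) - (sigma, t))%C = Rabs (u - t)).
  { replace ((sigma, u) - (sigma, t))%C with (Ci * RtoC (u - t))%C
      by (apply injective_projections; simpl; ring).
    now rewrite Cmod_mult, Cmod_R, Cmod_Ci, Rmult_1_l. }
  assert (hb : Cmod ((sigma, u) - (sigma, t))%C < delta) by now rewrite hdist.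
  specialize (hdelta (sigma, u) hb).
  change (Cmod (f (sigma, u) - f (sigma, t) - ((sigma, u) - (sigma, t)) * l)%C
    <= eps * Cmod ((sigma, u) - (sigma, t))%C) in hdelta.
  rewrite hdist in hdelta.
  replace (0, u - t)%R with ((sigma, u) - (sigma, t))%C; [exact hdelta|].
  apply injective_projections; simpl; ring. }
(* Each component of the complex remainder is at most its modulus. *)
split; split; try apply is_linear_scal_l; intros x hx eps;
  rewrite <- (is_filter_lim_locally_unique _ _ hx);
  destruct (hd' eps) as [delta hdelta]; exists delta; intros u hu;
  refine (Rle_trans _ _ _ _ (hdelta u hu));
  refine (Rle_trans _ _ _ _ (Rmax_Cmod _));
  [refine (Rle_trans _ _ _ _ (Rmax_l _ _)) | refine (Rle_trans _ _ _ _ (Rmax_r _ _))];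
  apply Req_le; unfold norm, minus, plus, opp, scal, mult, Re, Im; simpl;
  unfold abs, mult; simpl; f_equal; unfold Re, Im; ring.
Qed.

(** All possible poles are real, so none lies in the upper half-plane. *)
Lemma is_barnes_zeta_ex_derive (a : R) (w : list R) (zeta : C -> C) (sigma t : R) :
  is_barnes_zeta a w zeta -> 0 < t ->
  @ex_derive C_AbsRing C_NormedModule zeta (sigma, t).
Proof.
intros [_ hz] ht.
destruct (hz (sigma, t)) as [h | [_ [j [_ h]]]].
- exact (locally_singleton _ _ h).
- injection h; intros; lra.
Qed.

(** The squared modulus is differentiable; composing with [sqrt] keeps only continuity, because of
    possible zeros of [f]. This makes the moments integrable. *)
Lemma Cmod_vertical_continuous (f : C -> C) (sigma t : R) :
  @ex_derive C_AbsRing C_NormedModule f (sigma, t) ->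
  continuous (fun u => Cmod (f (sigma, u))) t.
Proof.
intros [l hl].
destruct (is_derive_vertical _ _ _ _ hl) as [h1 h2].
unfold Cmod.
apply (continuous_comp (fun u => fst (f (sigma, u)) ^ 2 + snd (f (sigma, u)) ^ 2) sqrt).
- apply (ex_derive_continuous (V := R_NormedModule)).
  exists (2 * - Im l * Re (f (sigma, t)) + 2 * Re l * Im (f (sigma, t))).
  apply (is_derive_ext (fun u => plus (Re (f (sigma, u)) ^ 2) (Im (f (sigma, u)) ^ 2))).
  { intros u; reflexivity. }
  replace (2 * - Im l * Re (f (sigma, t)) + 2 * Re l * Im (f (sigma, t)))
    with (plus (INR 2 * - Im l * Re (f (sigma, t)) ^ 1)
               (INR 2 * Re l * Im (f (sigma, t)) ^ 1))
    by (unfold plus; simpl; ring).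
  apply (is_derive_plus (V := R_NormedModule)).
  + now apply (is_derive_pow (fun u => Re (f (sigma, u))) 2).
  + now apply (is_derive_pow (fun u => Im (f (sigma, u))) 2).
- apply continuous_sqrt.
Qed.

(** The mean value inequality is applied to the real and imaginary parts separately; adding the two
    bounds gives the factor 2. *)
Lemma Cmod_vertical_variation (f : C -> C) (sigma D x y : R) :
  (forall t, Rabs (t - x) <= Rabs (y - x) ->
     @ex_derive C_AbsRing C_NormedModule f (sigma, t) /\
     Cmod (C_derive f (sigma, t)) <= D) ->
  Rabs (Cmod (f (sigma, y)) - Cmod (f (sigma, x))) <= 2 * D * Rabs (y - x).
Proof.
intros h.
assert (hre : Rabs (Re (f (sigma, y)) - Re (f (sigma, x))) <= D * Rabs (y - x)).
{ apply (bounded_variation (fun u => Re (f (sigma, u)))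
    (fun u => - Im (C_derive f (sigma, u)))).
  intros t ht; destruct (h t ht) as [h1 h2]; split.
  - now apply (is_derive_vertical f), C_derive_correct.
  - rewrite Rabs_Ropp.
    refine (Rle_trans _ _ _ (Rle_trans _ _ _ _ (Rmax_Cmod _)) h2); apply Rmax_r. }
assert (him : Rabs (Im (f (sigma, y)) - Im (f (sigma, x))) <= D * Rabs (y - x)).
{ apply (bounded_variation (fun u => Im (f (sigma, u)))
    (fun u => Re (C_derive f (sigma, u)))).
  intros t ht; destruct (h t ht) as [h1 h2]; split.
  - now apply (is_derive_vertical f), C_derive_correct.
  - refine (Rle_trans _ _ _ (re_le_Cmod _) h2). }
(* Reverse triangle inequality, then [|z| <= |Re z| + |Im z|]. *)
refine (Rle_trans _ (Cmod (f (sigma, y) - f (sigma, x))%C) _ _ _).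
- apply Rabs_le_between'.
  pose proof (Cmod_triangle (f (sigma, x)) (f (sigma, y) - f (sigma, x))%C) as h1.
  pose proof (Cmod_triangle (f (sigma, y)) (- (f (sigma, y) - f (sigma, x)))%C) as h2.
  rewrite Cmod_opp in h2.
  replace (f (sigma, x) + (f (sigma, y) - f (sigma, x)))%C with (f (sigma, y)) in h1 by ring.
  replace (f (sigma, y) + - (f (sigma, y) - f (sigma, x)))%C with (f (sigma, x)) in h2 by ring.
  lra.
- set (z := (f (sigma, y) - f (sigma, x))%C).
  assert (hz : Cmod z <= Rabs (Re z) + Rabs (Im z)).
  { replace z with (RtoC (Re z) + Ci * RtoC (Im z))%C at 1
      by (apply injective_projections; simpl; unfold Re, Im; ring).
    refine (Rle_trans _ _ _ (Cmod_triangle _ _) _).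
    rewrite Cmod_mult, !Cmod_R, Cmod_Ci; lra. }
  change (Re z) with (Re (f (sigma, y)) - Re (f (sigma, x))) in hz.
  change (Im z) with (Im (f (sigma, y)) - Im (f (sigma, x))) in hz.
  lra.
Qed.

(** * Moments from pointwise bounds *)

Lemma ex_RInt_pow (F : R -> R) (n : nat) (a b : R) :
  (forall t, 2 <= t -> continuous F t) -> 2 <= a -> 2 <= b ->
  ex_RInt (fun t => F t ^ n) a b.
Proof.
intros hF ha hb.
apply (ex_RInt_continuous (V := R_CompleteNormedModule)); intros t ht.
assert (h2 : 2 <= t).
{ refine (Rle_trans _ _ _ _ (proj1 ht)); now apply Rmin_glb. }
induction n as [|n IH].
- apply continuous_const.
- now apply (continuous_mult (K := R_AbsRing) F); [apply hF|].
Qed.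

(** The exponent [eps / (2k)] becomes [eps] in the [2k]-th power, and integration over a length at
    most [T] contributes one more factor [T]. *)
Lemma moment_le_of_pointwise (F : R -> R) (k : nat) (eps : R) :
  (forall t, 2 <= t -> continuous F t) -> 0 < eps -> (1 <= k)%nat ->
  bigO_infty F (fun t => Rpower t (eps / INR (2 * k))) ->
  bigO_infty (fun T => RInt (fun t => F t ^ (2 * k)) 2 T)
             (fun T => Rpower T (1 + eps)).
Proof.
intros hF heps hk [K [M hM]].
assert (hn : 0 < INR (2 * k)) by (apply lt_0_INR; lia).
set (n := (2 * k)%nat) in *.
(* The pointwise bound holds only strictly beyond [M], so the integral is cut at a point past
   [M]. *)
set (M1 := Rmax 2 (M + 1)).
assert (hM1 : 2 <= M1) by apply Rmax_l.
assert (hM1' : M < M1) by (pose proof (Rmax_r 2 (M + 1)); unfold M1; lra).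
set (I0 := RInt (fun t => F t ^ n) 2 M1).
(* The fixed part over [[2, M1]] is absorbed since [T ^ (1 + eps) >= 1]; the rest is at most
   [(T - M1) |K| ^ n T ^ eps]. *)
exists (Rabs I0 + Rabs K ^ n), M1; intros T hT.
pose proof (Rpower_ge_1 T (1 + eps) ltac:(lra) ltac:(lra)) as h1.
rewrite (Rabs_pos_eq (Rpower T _)) by lra.
rewrite <- (RInt_Chasles (V := R_CompleteNormedModule) _ 2 M1 T);
  try (apply ex_RInt_pow; auto; lra).
refine (Rle_trans _ _ _ (Rabs_triang _ _) _); fold I0.
rewrite Rmult_plus_distr_r; apply Rplus_le_compat.
- rewrite <- (Rmult_1_r (Rabs I0)) at 1.
  apply Rmult_le_compat_l; [apply Rabs_pos | exact h1].
- pose proof (pow_le _ n (Rabs_pos K)) as hK.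
  refine (Rle_trans _ ((T - M1) * (Rabs K ^ n * Rpower T eps)) _ _ _).
  + apply abs_RInt_le_const; [lra | apply ex_RInt_pow; auto; lra |].
    intros t ht; rewrite <- RPow_abs.
    specialize (hM t ltac:(lra)).
    assert (hp : 0 < Rpower t (eps / INR n)) by apply exp_pos.
    rewrite (Rabs_pos_eq (Rpower t _)) in hM by lra.
    refine (Rle_trans _ ((Rabs K * Rpower t (eps / INR n)) ^ n) _ _ _).
    * apply pow_incr; split; [apply Rabs_pos|].
      refine (Rle_trans _ _ _ hM _).
      apply Rmult_le_compat_r; [lra | apply Rle_abs].
    * rewrite Rpow_mult_distr, Rpower_pow_mult.
      replace (INR n * (eps / INR n)) with eps by (field; lra).
      apply Rmult_le_compat_l; [exact hK|].
      apply Rle_Rpower_l; lra.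
  + rewrite Rpower_plus, Rpower_1 by lra.
    assert (hp : 0 <= Rabs K ^ n * Rpower T eps)
      by (apply Rmult_le_pos; [exact hK | apply Rlt_le, exp_pos]).
    replace (Rabs K ^ n * (T * Rpower T eps))
      with (T * (Rabs K ^ n * Rpower T eps)) by ring.
    apply Rmult_le_compat_r; lra.
Qed.

(** * Pointwise bounds from moments *)

Lemma exists_nat_mult_ge (x eps : R) :
  0 < eps -> exists k : nat, (1 <= k)%nat /\ x <= INR (2 * k) * eps.
Proof.
intros heps.
destruct (INR_unbounded (x / eps)) as [k hk].
exists (S k); split; [lia|].
apply (Rmult_lt_compat_r eps) in hk; [|exact heps].
replace (x / eps * eps) with x in hk by (field; lra).
refine (Rle_trans _ _ _ (Rlt_le _ _ hk) _).
apply Rmult_le_compat_r; [lra | apply le_INR; lia].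
Qed.

(** One fixed moment exponent, here 2, suffices: a large [k] absorbs it. The variation bound on unit
    intervals covers [[t, t + t ^ - B]], whose length is at most 1. *)
Lemma pointwise_of_moments (F : R -> R) (B L eps : R) :
  (forall t, 2 <= t -> continuous F t) -> (forall t, 0 <= F t) ->
  0 < B -> 0 <= L -> 0 < eps ->
  (forall t u, 4 <= t -> t <= u <= t + 1 ->
     Rabs (F u - F t) <= L * Rpower t B * (u - t)) ->
  (forall k, (1 <= k)%nat ->
     bigO_infty (fun T => RInt (fun t => F t ^ (2 * k)) 2 T)
                (fun T => Rpower T (1 + 1))) ->
  bigO_infty F (fun t => Rpower t eps).
Proof.
intros hF hF0 hB hL heps hvar hmom.
destruct (exists_nat_mult_ge (B + 2) eps heps) as [k [hk hke]].
destruct (hmom k hk) as [K [M hM]].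
assert (hn : (1 <= 2 * k)%nat) by lia.
set (n := (2 * k)%nat) in *.
(* [2 ^ n] undoes the halving of [F t], and 4 comes from [(t + delta) ^ 2 <= 4 t ^ 2]. *)
set (Q := Rmax 1 (2 ^ n * (Rabs K * 4))).
exists (2 * L + Q), (Rmax 4 M); intros t ht.
assert (h4 : 4 < t) by (pose proof (Rmax_l 4 M); lra).
assert (hMt : M < t) by (pose proof (Rmax_r 4 M); lra).
assert (hQ : 1 <= Q) by apply Rmax_l.
pose proof (Rpower_ge_1 t eps ltac:(lra) ltac:(lra)) as hte.
rewrite (Rabs_pos_eq (F t)) by apply hF0.
rewrite (Rabs_pos_eq (Rpower t eps)) by lra.
(* [F] varies by at most [L] over a length [t ^ - B], which is less than [F t / 2] once
   [F t > 2 L]. *)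
destruct (Rle_lt_dec (F t) (2 * L)) as [hs | hs].
{ refine (Rle_trans _ _ _ hs _).
  rewrite <- (Rmult_1_r (2 * L)) at 1.
  apply Rmult_le_compat; lra. }
set (delta := Rpower t (- B)).
assert (hd0 : 0 < delta) by apply exp_pos.
pose proof (Rpower_ge_1 t B ltac:(lra) ltac:(lra)) as htB.
assert (hdB : Rpower t B * delta = 1).
{ unfold delta; rewrite Rpower_Ropp; apply Rinv_r; lra. }
assert (hd1 : delta <= 1) by nra.
assert (hlow : forall u, t <= u <= t + delta -> F t / 2 <= F u).
{ intros u hu.
  pose proof (hvar t u ltac:(lra) ltac:(lra)) as h.
  apply Rabs_le_between in h.
  assert (h' : L * Rpower t B * (u - t) <= L).
  { rewrite Rmult_assoc; rewrite <- (Rmult_1_r L) at 2.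
    apply Rmult_le_compat_l; [exact hL|].
    rewrite <- hdB; apply Rmult_le_compat_l; lra. }
  lra. }
(* The lower bound is integrated over the short interval; by nonnegativity that integral is at most
   the whole moment up to [t + delta]. *)
assert (hint : delta * (F t / 2) ^ n <= Rabs K * (4 * Rpower t 2)).
{ refine (Rle_trans _ (RInt (fun u => F u ^ n) t (t + delta)) _ _ _).
  - replace (delta * (F t / 2) ^ n)
      with (RInt (fun _ => (F t / 2) ^ n) t (t + delta))
      by (rewrite RInt_const; unfold scal; simpl; unfold mult; simpl; ring).
    apply RInt_le; [lra | apply ex_RInt_const | apply ex_RInt_pow; auto; lra |].
    intros u hu; apply pow_incr; split; [|apply hlow; lra].
    specialize (hF0 t); lra.
  - specialize (hM (t + delta) ltac:(lra)).
    apply (Rle_trans _ (RInt (fun u => F u ^ n) 2 (t + delta))).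
    + rewrite <- (RInt_Chasles (V := R_CompleteNormedModule) _ 2 t (t + delta));
        try (apply ex_RInt_pow; auto; lra).
      assert (h0 : 0 <= RInt (fun u => F u ^ n) 2 t).
      { apply RInt_ge_0; [lra | apply ex_RInt_pow; auto; lra |].
        intros; apply pow_le, hF0. }
      unfold plus; simpl; lra.
    + refine (Rle_trans _ _ _ (Rle_abs _) (Rle_trans _ _ _ hM _)).
      rewrite (Rabs_pos_eq (Rpower _ _)) by apply Rlt_le, exp_pos.
      apply Rmult_le_compat; [ | apply Rlt_le, exp_pos | apply Rle_abs |].
      2: { replace (1 + 1) with (INR 2) by (simpl; ring).
           replace 2 with (INR 2) at 1 by (simpl; ring).
           rewrite !Rpower_pow by lra; simpl; nra. }
      destruct (Rle_lt_dec 0 K) as [hK | hK]; [exact hK|].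
      exfalso.
      assert (h0 : 0 < Rabs (Rpower (t + delta) (1 + 1)))
        by (apply Rabs_pos_lt, Rgt_not_eq, exp_pos).
      pose proof (Rabs_pos (RInt (fun u => F u ^ n) 2 (t + delta))).
      nra. }
set (q := F t / Rpower t eps).
assert (hq0 : 0 <= q) by (apply Rdiv_le_0_compat; [apply hF0 | lra]).
assert (hFq : F t = q * Rpower t eps) by (unfold q; field; lra).
assert (hqn : q ^ n <= 2 ^ n * (Rabs K * 4)).
(* Here the choice of [k] enters: [B + 2 <= n eps]. *)
{ assert (hX : Rpower t (B + 2) <= Rpower t eps ^ n).
  { rewrite Rpower_pow_mult; apply Rle_Rpower; lra. }
  assert (hX0 : 0 < Rpower t (B + 2)) by apply exp_pos.
  apply (Rmult_le_reg_r (Rpower t (B + 2))); [exact hX0|].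
  apply (Rle_trans _ (F t ^ n)).
  - rewrite hFq, Rpow_mult_distr.
    apply Rmult_le_compat_l; [now apply pow_le | exact hX].
  - replace (F t) with (2 * (F t / 2)) by field.
    rewrite Rpow_mult_distr, Rmult_assoc.
    apply Rmult_le_compat_l; [apply pow_le; lra|].
    rewrite Rpower_plus.
    apply (Rmult_le_compat_l (Rpower t B)) in hint; [|lra].
    rewrite <- Rmult_assoc, hdB, Rmult_1_l in hint.
    replace (Rabs K * 4 * (Rpower t B * Rpower t 2))
      with (Rpower t B * (Rabs K * (4 * Rpower t 2))) by ring.
    exact hint. }
assert (hqQ : q <= Q).
(* For [q > 1], [q <= q ^ n] bounds [q] without taking an [n]-th root. *)
{ destruct (Rle_lt_dec q 1) as [h1 | h1]; [lra|].
  apply (Rle_trans _ (q ^ n)).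
  - rewrite <- (pow_1 q) at 1; apply Rle_pow; [lra | exact hn].
  - refine (Rle_trans _ _ _ hqn (Rmax_r _ _)). }
rewrite hFq; apply Rmult_le_compat_r; lra.
Qed.

Theorem theorem2p2 (r d : nat) (a : R) (w : list R) (zeta : C -> C)
    (hr : (1 <= r)%nat) (ha : 0 < a)
    (hw_length : length w = r) (hw_pos : List.Forall (fun x => 0 < x) w)
    (hd : Qspan_dim w d)
    (hzeta : is_barnes_zeta a w zeta)
    (hgrowth : polynomial_growth (C_derive zeta) (INR r - INR d / 2) (INR r)) :
  (forall eps sigma : R, 0 < eps -> INR r - INR d / 2 <= sigma <= INR r ->
     bigO_infty (fun t => Cmod (zeta (sigma, t))) (fun t => Rpower t eps))
  <->
  (forall (k : nat) (eps sigma : R), (1 <= k)%nat -> 0 < eps ->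
     INR r - INR d / 2 <= sigma <= INR r ->
     bigO_infty (fun T => RInt (fun t => Cmod (zeta (sigma, t)) ^ (2 * k)) 2 T)
                (fun T => Rpower T (1 + eps))).
Proof.
assert (hcont : forall sigma t, 2 <= t ->
  continuous (fun u => Cmod (zeta (sigma, u))) t).
{ intros sigma t ht.
  apply Cmod_vertical_continuous, (is_barnes_zeta_ex_derive a w); [exact hzeta | lra]. }
split.
- intros hi k eps sigma hk heps hsigma.
  apply (moment_le_of_pointwise (fun t => Cmod (zeta (sigma, t))));
    [apply hcont | exact heps | exact hk |].
  apply hi; [|exact hsigma].
  apply Rdiv_lt_0_compat; [exact heps | apply lt_0_INR; lia].
- intros hii eps sigma heps hsigma.
  destruct hgrowth as [B [hB [K hK]]].
  assert (hK0 : 0 <= K).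
  { specialize (hK sigma 2 hsigma ltac:(lra)).
    pose proof (Cmod_ge_0 (C_derive zeta (sigma, 2))) as h0.
    assert (hp : 0 < Rpower 2 B) by apply exp_pos.
    nra. }
  (* The outer 2 is the factor in the variation of the modulus; [2 ^ B] comes from bounding the
     derivative by [K (2 t) ^ B] near [t]. *)
  apply (pointwise_of_moments _ B (2 * (K * Rpower 2 B)));
    [apply hcont | intros; apply Cmod_ge_0 | exact hB | | exact heps | |].
  + apply Rmult_le_pos; [lra|].
    apply Rmult_le_pos; [exact hK0 | apply Rlt_le, exp_pos].
  + intros t u ht hu.
    rewrite <- (Rabs_pos_eq (u - t)) by lra.
    replace (2 * (K * Rpower 2 B) * Rpower t B)
      with (2 * (K * Rpower (2 * t) B))
      by (rewrite <- Rpower_mult_distr by lra; ring).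
    apply (Cmod_vertical_variation zeta); intros v hv.
    rewrite (Rabs_pos_eq (u - t)) in hv by lra.
    (* Since [t >= 4] and [|v - t| <= 1], one has [2 <= v <= 2 t], so the growth hypothesis applies
       at [v]. *)
    apply Rabs_le_between in hv.
    split; [apply (is_barnes_zeta_ex_derive a w); [exact hzeta | lra]|].
    refine (Rle_trans _ _ _ (hK sigma v hsigma _) _); [lra|].
    apply Rmult_le_compat_l; [exact hK0|].
    apply Rle_Rpower_l; lra.
  + intros k hk; apply hii; [exact hk | lra | exact hsigma].
Qed.
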